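(* Let $\mathcal{X}=(M\xrightarrow{\partial}N,\cdot,\{-,-\})$ be a braided crossed module of Lie $K$-algebras. Then $\mathcal{X}$ has a universal central extension (in the category of braided crossed modules of Lie $K$-algebras) if and only if $\mathcal{X}$ is perfect as a braided crossed module.
   Context: $K$ is a fixed field; all Lie algebras and Lie homomorphisms are over $K$. A crossed module of Lie algebras $(M\xrightarrow{\partial}N,\cdot)$ consists of a Lie action of $N$ on $M$, i.e. a $K$-bilinear map $\cdot\colon N\times M\to M$ with $[n,n']\cdot m=n\cdot(n'\cdot m)-n'\cdot(n\cdot m)$ and $n\cdot[m,m']=[n\cdot m,m']+[m,n\cdot m']$, and a Lie homomorphism $\partial\colon M\to N$ with $\partial(n\cdot m)=[n,\partial(m)]$ and $\partial(m)\cdot m'=[m,m']$. A braiding on it is a $K$-bilinear map $\{-,-\}\colon N\times N\to M$ such that, for all $m,m'\in M$, $n,n',n''\in N$: $\partial\{n,n'\}=[n,n']$; $\{\partial m,\partial m'\}=[m,m']$; $\{\partial m,n\}=-n\cdot m$; $\{n,\partial m\}=n\cdot m$; $\{n,[n',n'']\}=\{[n,n'],n''\}-\{[n,n''],n'\}$; $\{[n,n'],n''\}=\{n,[n',n'']\}-\{n',[n,n'']\}$. Then $(M\xrightarrow{\partial}N,\cdot,\{-,-\})$ is a braided crossed module. A morphism of braided crossed modules from $(M\xrightarrow{\partial}N,\cdot,\{-,-\})$ to $(L\xrightarrow{\delta}H,*,\langle-,-\rangle)$ is a pair of Lie homomorphisms $f_1\colon M\to L$, $f_2\colon N\to H$ with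 $f_1(n\cdot m)=f_2(n)*f_1(m)$, $\delta\circ f_1=f_2\circ\partial$ and $f_1(\{n,n'\})=\langle f_2(n),f_2(n')\rangle$. For a braided crossed module $(M\xrightarrow{\partial}N,\cdot,\{-,-\})$ of Lie $K$-algebras put $M^N=\{m\in M\mid n\cdot m=0\ \forall n\in N\}$ and $Z_B(N)=\{n\in N\mid \{n,n'\}=0=\{n',n\}\ \forall n'\in N\}$. An extension of braided crossed modules is a morphism $(f_1,f_2)$ with $f_1,f_2$ surjective; an extension with domain $(M\xrightarrow{\partial}N,\cdot,\{-,-\})$ is central if $\ker(f_1)\subset M^N$ and $\ker(f_2)\subset Z_B(N)$. A central extension $u\colon\mathcal{U}\to\mathcal{X}$ is universal if for every central extension $f\colon\mathcal{Z}\to\mathcal{X}$ there is a unique morphism of braided crossed modules $h\colon\mathcal{U}\to\mathcal{Z}$ with $u=f\circ h$. For a braided crossed module $(M\xrightarrow{\partial}N,\cdot,\{-,-\})$, let $B_N(M)$ be the Lie subalgebra of $M$ generated by all $\{n,n'\}$, $n,n'\in N$. The braided crossed module is perfect if $M=B_N(M)$ and $N=[N,N]$. *)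

(* Defs.v *)
From HB Require Import structures.
From mathcomp Require Import all_boot all_algebra.
From mathcomp Require Import boolp classical_sets.

Set Implicit Arguments.
Unset Strict Implicit.
Unset Printing Implicit Defensive.

Import GRing.Theory.

Local Open Scope classical_set_scope.
Local Open Scope ring_scope.

Reserved Notation "⟦ x , y ⟧" (at level 0, format "⟦ x ,  y ⟧").
Reserved Notation "⦃ x , y ⦄" (at level 0, format "⦃ x ,  y ⦄").

HB.mixin Record Lmodule_isLieAlgebra (K : fieldType) L
    of GRing.Lmodule K L := {
  lie_bracket : L -> L -> L;
  lie_bracket_bilinear : bilinear_for *:%R *:%R lie_bracket;
  lie_bracketxx : forall x, lie_bracket x x = 0;
  lie_jacobi : forall x y z,
    lie_bracket x (lie_bracket y z) + lie_bracket y (lie_bracket z x)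
      + lie_bracket z (lie_bracket x y) = 0
}.

#[short(type="lieAlgType")]
HB.structure Definition LieAlgebra (K : fieldType) :=
  {L of GRing.Lmodule K L & Lmodule_isLieAlgebra K L}.

Notation "⟦ x , y ⟧" := (lie_bracket x y) : ring_scope.

Section LieAlgebras.
Variables (K : fieldType) (L : lieAlgType K).

Definition lie_morphism (H : lieAlgType K) (f : L -> H) : Prop :=
  linear f /\ (forall x y, f ⟦x, y⟧ = ⟦f x, f y⟧).

Definition is_subspace (S : set L) : Prop :=
  S 0 /\ (forall (a : K) x y, S x -> S y -> S (a *: x + y)).

Definition is_lie_subalgebra (S : set L) : Prop :=
  is_subspace S /\ (forall x y, S x -> S y -> S ⟦x, y⟧).

Definition lie_generated (G : set L) : set L := smallest is_lie_subalgebra G.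

(* [L, L], the linear span of all brackets *)
Definition lie_derived : set L :=
  smallest is_subspace [set ⟦x, y⟧ | x in [set: L] & y in [set: L]].

End LieAlgebras.
Arguments lie_derived {K} L.

Record crossedModule (K : fieldType) := CrossedModule {
  xm_dom : lieAlgType K;
  xm_cod : lieAlgType K;
  xm_bd : xm_dom -> xm_cod;
  xm_act : xm_cod -> xm_dom -> xm_dom;
  xm_bd_morphism : lie_morphism xm_bd;
  xm_act_bilinear : bilinear_for *:%R *:%R xm_act;
  xm_act_bracketl : forall n n' m,
    xm_act ⟦n, n'⟧ m = xm_act n (xm_act n' m) - xm_act n' (xm_act n m);
  xm_act_bracketr : forall n m m',
    xm_act n ⟦m, m'⟧ = ⟦xm_act n m, m'⟧ + ⟦m, xm_act n m'⟧;
  xm_bd_act : forall n m, xm_bd (xm_act n m) = ⟦n, xm_bd m⟧;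
  xm_peiffer : forall m m', xm_act (xm_bd m) m' = ⟦m, m'⟧
}.

Record braidedCrossedModule (K : fieldType) := BraidedCrossedModule {
  bxm_xm :> crossedModule K;
  bxm_br : xm_cod bxm_xm -> xm_cod bxm_xm -> xm_dom bxm_xm
    where "⦃ n , n' ⦄" := (bxm_br n n');
  bxm_br_bilinear : bilinear_for *:%R *:%R bxm_br;
  bxm_bd_br : forall n n', xm_bd ⦃n, n'⦄ = ⟦n, n'⟧;
  bxm_br_bd : forall m m' : xm_dom bxm_xm, ⦃xm_bd m, xm_bd m'⦄ = ⟦m, m'⟧;
  bxm_br_bdl : forall (m : xm_dom bxm_xm) n, ⦃xm_bd m, n⦄ = - xm_act n m;
  bxm_br_bdr : forall n (m : xm_dom bxm_xm), ⦃n, xm_bd m⦄ = xm_act n m;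
  bxm_br_bracketr : forall n n' n'',
    ⦃n, ⟦n', n''⟧⦄ = ⦃⟦n, n'⟧, n''⦄ - ⦃⟦n, n''⟧, n'⦄;
  bxm_br_bracketl : forall n n' n'',
    ⦃⟦n, n'⟧, n''⦄ = ⦃n, ⟦n', n''⟧⦄ - ⦃n', ⟦n, n''⟧⦄
}.

Notation "⦃ n , n' ⦄" := (bxm_br n n') : ring_scope.

Record bxmMorphism (K : fieldType) (X Y : braidedCrossedModule K) :=
    BxmMorphism {
  bxm_fst : xm_dom X -> xm_dom Y;
  bxm_snd : xm_cod X -> xm_cod Y;
  bxm_fst_morphism : lie_morphism bxm_fst;
  bxm_snd_morphism : lie_morphism bxm_snd;
  bxm_fst_act : forall n m,
    bxm_fst (xm_act n m) = xm_act (bxm_snd n) (bxm_fst m);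
  bxm_morph_bd : forall m, xm_bd (bxm_fst m) = bxm_snd (xm_bd m);
  bxm_fst_br : forall n n', bxm_fst ⦃n, n'⦄ = ⦃bxm_snd n, bxm_snd n'⦄
}.

Section Morphisms.
Variable K : fieldType.

Lemma bxmMorphism_eq (X Y : braidedCrossedModule K) (f g : bxmMorphism X Y) :
  bxm_fst f =1 bxm_fst g -> bxm_snd f =1 bxm_snd g -> f = g.
Proof.
case: f g => [f1 f2 ? ? ? ? ?] [g1 g2 ? ? ? ? ?] /= /funext e1 /funext e2.
by subst g1 g2; congr BxmMorphism; exact: Prop_irrelevance.
Qed.

Lemma lie_morphism_comp (L1 L2 L3 : lieAlgType K)
    (g : L2 -> L3) (f : L1 -> L2) :
  lie_morphism g -> lie_morphism f -> lie_morphism (g \o f).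
Proof.
move=> [gl gb] [fl fb]; split=> [a x y|x y] /=; first by rewrite fl gl.
by rewrite fb gb.
Qed.

Variables X Y Z : braidedCrossedModule K.
Variables (g : bxmMorphism Y Z) (f : bxmMorphism X Y).

Fact bxm_comp_act n m :
  (bxm_fst g \o bxm_fst f) (xm_act n m) =
  xm_act ((bxm_snd g \o bxm_snd f) n) ((bxm_fst g \o bxm_fst f) m).
Proof. by rewrite /= !bxm_fst_act. Qed.

Fact bxm_comp_bd m :
  xm_bd ((bxm_fst g \o bxm_fst f) m) = (bxm_snd g \o bxm_snd f) (xm_bd m).
Proof. by rewrite /= !bxm_morph_bd. Qed.

Fact bxm_comp_br n n' :
  (bxm_fst g \o bxm_fst f) ⦃n, n'⦄ =
  ⦃(bxm_snd g \o bxm_snd f) n, (bxm_snd g \o bxm_snd f) n'⦄.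
Proof. by rewrite /= !bxm_fst_br. Qed.

Definition bxm_comp : bxmMorphism X Z :=
  BxmMorphism
    (lie_morphism_comp (bxm_fst_morphism g) (bxm_fst_morphism f))
    (lie_morphism_comp (bxm_snd_morphism g) (bxm_snd_morphism f))
    bxm_comp_act bxm_comp_bd bxm_comp_br.

End Morphisms.

Section Extensions.
Variable K : fieldType.
Implicit Types X U : braidedCrossedModule K.

(* M^N *)
Definition bxm_invariants X : set (xm_dom X) :=
  [set m | forall n : xm_cod X, xm_act n m = 0].
Arguments bxm_invariants X : clear implicits.

(* Z_B(N) *)
Definition bxm_center X : set (xm_cod X) :=
  [set n | forall n' : xm_cod X, ⦃n, n'⦄ = 0 /\ ⦃n', n⦄ = 0].
Arguments bxm_center X : clear implicits.

(* B_N(M) *)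
Definition bxm_br_subalgebra X : set (xm_dom X) :=
  lie_generated [set ⦃n, n'⦄ | n in [set: xm_cod X] & n' in [set: xm_cod X]].
Arguments bxm_br_subalgebra X : clear implicits.

Definition bxm_perfect X : Prop :=
  [set: xm_dom X] = bxm_br_subalgebra X /\
  [set: xm_cod X] = lie_derived (xm_cod X).

Definition bxm_extension U X (u : bxmMorphism U X) : Prop :=
  (forall m, exists m', bxm_fst u m' = m) /\
  (forall n, exists n', bxm_snd u n' = n).

Definition bxm_central_extension U X (u : bxmMorphism U X) : Prop :=
  [/\ bxm_extension u,
      [set m | bxm_fst u m = 0] `<=` bxm_invariants U
    & [set n | bxm_snd u n = 0] `<=` bxm_center U].

Definition bxm_universal_central_extension U X (u : bxmMorphism U X) : Prop :=
  bxm_central_extension u /\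
  (forall Z (f : bxmMorphism Z X), bxm_central_extension f ->
     exists! h : bxmMorphism U Z, u = bxm_comp f h).

End Extensions.
Arguments bxm_invariants {K} X.
Arguments bxm_center {K} X.
Arguments bxm_br_subalgebra {K} X.

(* Main.v *)
(* If X = (M -> N) is perfect, then in any central extension Z -> X the braiding
   of Z only depends on the images in N of its arguments, so that it induces an
   alternating pairing N x N -> Z_1. Hence the crossed module id : T -> T, where
   T is the exterior square of the Lie algebra N (the target of the universal
   such pairing) and the braiding is the Lie bracket of T, maps to every central
   extension of X. The map is unique because T is spanned by its brackets.

   Conversely, for an abelian crossed module A, every morphism g : X -> A
   vanishes as soon as X has a universal central extension u, since (u, g u) and
   (u, 0) both lift u to the central extension X x A -> X. Quotient maps to
   N / [N, N] and M / B_N(M) provide such morphisms g. *)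

Require Import Defs.
From mathcomp Require Import all_boot all_algebra.
From HB Require Import structures.
From mathcomp Require Import boolp classical_sets.

Set Implicit Arguments.
Unset Strict Implicit.
Unset Printing Implicit Defensive.

Import GRing.Theory.

Local Open Scope classical_set_scope.
Local Open Scope quotient_scope.
Local Open Scope ring_scope.

(** * Linear maps and identities in Lie algebras *)

Section Linear.
Variables (K : fieldType) (V W : lmodType K) (f : V -> W).
Hypothesis f_lin : linear f.

Definition linear_of : {linear V -> W} :=
  HB.pack f (GRing.isLinear.Build _ _ _ _ f f_lin).

Lemma lin0 : f 0 = 0. Proof. exact: (linear0 linear_of). Qed.
Lemma linN : {morph f : x / - x}. Proof. exact: (linearN linear_of). Qed.
Lemma linD : {morph f : x y / x + y}. Proof. exact: (linearD linear_of). Qed.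
Lemma linB : {morph f : x y / x - y}. Proof. exact: (linearB linear_of). Qed.
Lemma linZ a : {morph f : x / a *: x}. Proof. exact: (linearZZ linear_of). Qed.
Lemma lin_sum I r (P : pred I) F :
  f (\sum_(i <- r | P i) F i) = \sum_(i <- r | P i) f (F i).
Proof. exact: (linear_sum linear_of). Qed.

End Linear.

Section LieAlgebraTheory.
Variables (K : fieldType) (L : lieAlgType K).
Implicit Types x y z : L.

Lemma lie_linl y : linear (fun x => ⟦x, y⟧).
Proof. by have [h _] := @lie_bracket_bilinear K L; exact: h. Qed.

Lemma lie_linr x : linear (lie_bracket x).
Proof. by have [_ h] := @lie_bracket_bilinear K L; exact: h. Qed.

Lemma lie_skew x y : ⟦x, y⟧ = - ⟦y, x⟧.
Proof.
apply/eqP; rewrite -addr_eq0; apply/eqP.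
have := lie_bracketxx (x + y).
by rewrite (linD (lie_linl _)) !(linD (lie_linr _)) !lie_bracketxx addr0 add0r.
Qed.

(** The Jacobi identity in the shape of the axiom [bxm_br_bracketr]. With its two rearrangements
    below, it makes the bracket of [L] both an action of [L] on itself and a braiding. *)
Lemma lie_bracketA x y z : ⟦x, ⟦y, z⟧⟧ = ⟦⟦x, y⟧, z⟧ - ⟦⟦x, z⟧, y⟧.
Proof.
have := lie_jacobi x y z; rewrite -addrA => /eqP; rewrite addr_eq0 => /eqP ->.
rewrite opprD addrC (lie_skew ⟦x, y⟧ z); congr (_ - _).
by rewrite (lie_skew _ y) (lie_skew x z) (linN (lie_linr _)) opprK.
Qed.

Lemma lie_bracketAl x y z : ⟦⟦x, y⟧, z⟧ = ⟦x, ⟦y, z⟧⟧ - ⟦y, ⟦x, z⟧⟧.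
Proof. by rewrite (lie_bracketA x) (lie_skew y) opprK addrNK. Qed.

Lemma lie_bracketAr x y z : ⟦x, ⟦y, z⟧⟧ = ⟦⟦x, y⟧, z⟧ + ⟦y, ⟦x, z⟧⟧.
Proof. by rewrite lie_bracketAl addrNK. Qed.

Lemma lie_subalgebra_generated (G : set L) : is_lie_subalgebra (lie_generated G).
Proof.
split; first split.
- by move=> S [[[]]].
- by move=> a x y xG yG S SG; apply: (SG.1.1.2); [exact: xG|exact: yG].
- by move=> x y xG yG S SG; apply: (SG.1.2); [exact: xG|exact: yG].
Qed.

Lemma subspace_derived : is_subspace (lie_derived L).
Proof.
split; first by move=> S [[]].
by move=> a x y xG yG S SG; apply: (SG.1.2); [exact: xG|exact: yG].
Qed.

Lemma derived_bracket x y : lie_derived L ⟦x, y⟧.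
Proof. by apply: sub_gen_smallest; exists x => //; exists y. Qed.

End LieAlgebraTheory.

(** * Quotient of a Lie algebra by a linear subspace, as a vector space *)

Section QuotientSpace.
Variables (K : fieldType) (V : lieAlgType K) (S : set V).
Hypothesis S_sub : is_subspace S.

Definition subspace_pred : pred V := fun x => `[< S x >].

Fact subspace_zmod_closed : zmod_closed subspace_pred.
Proof.
split=> [|x y]; rewrite !unfold_in; first by apply/asboolP; exact: S_sub.1.
move=> /asboolP Sx /asboolP Sy; apply/asboolP.
by rewrite addrC -scaleN1r; exact: S_sub.2.
Qed.

Definition subspace_zmod : zmodClosed V :=
  HB.pack subspace_pred
    (GRing.isZmodClosed.Build V subspace_pred subspace_zmod_closed).

Local Notation Q := {ideal_quot subspace_zmod}.

Definition quot_scale (a : K) (x : Q) : Q := \pi_Q (a *: repr x).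

(** The chosen representative differs from [x] by an element of [S], and [S] is stable under
    scalars. *)
Lemma pi_quot_scale a x : quot_scale a (\pi_Q x) = \pi_Q (a *: x).
Proof.
apply/eqP; rewrite -Quotient.idealrBE -scalerBr.
have : repr (\pi_Q x) - x \in subspace_zmod by rewrite Quotient.idealrBE reprK.
rewrite !unfold_in => /asboolP Sx; apply/asboolP.
by rewrite -[_ *: _]addr0; apply: S_sub.2 => //; exact: S_sub.1.
Qed.

Fact quot_scaleA a b v : quot_scale a (quot_scale b v) = quot_scale (a * b) v.
Proof.
by elim/quotW: v => v; rewrite (pi_quot_scale b) !pi_quot_scale scalerA.
Qed.

Fact quot_scale1 : left_id 1 quot_scale.
Proof. by elim/quotW=> v; rewrite pi_quot_scale scale1r. Qed.

Fact quot_scaleDr : right_distributive quot_scale +%R.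
Proof.
move=> a; elim/quotW=> u; elim/quotW=> v.
by rewrite -(raddfD \pi_Q) !pi_quot_scale scalerDr raddfD.
Qed.

Fact quot_scaleDl v : {morph quot_scale^~ v : a b / a + b}.
Proof.
by move=> a b; elim/quotW: v => v; rewrite !pi_quot_scale scalerDl raddfD.
Qed.

Definition quotient_lmod : lmodType K :=
  HB.pack Q (GRing.Zmodule_isLmodule.Build K Q
    quot_scaleA quot_scale1 quot_scaleDr quot_scaleDl).

(** Packages the quotient by its kernel alone: to prove [S x] it is enough to show that [q] kills
    [x]. *)
Lemma quotient_lmodP :
  exists (W : lmodType K) (q : V -> W), linear q /\ forall x, q x = 0 <-> S x.
Proof.
exists quotient_lmod, (\pi_Q : V -> quotient_lmod); split.
  move=> a x y; rewrite raddfD; congr (_ + _); exact/esym/pi_quot_scale.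
move=> x; have -> : (0 : quotient_lmod) = \pi_Q 0 by rewrite raddf0.
split=> [/eqP|Sx]; first by rewrite -Quotient.idealrBE subr0 => /asboolP.
by apply/eqP; rewrite -Quotient.idealrBE subr0; apply/asboolP.
Qed.

End QuotientSpace.

(** * The exterior square of a Lie algebra *)

Section ExteriorSquare.
Variables (K : fieldType) (N : lieAlgType K).

(* Alternating form of the crossed pairings of R. Brown and J.-L. Loday. *)
Definition lie_pairing (L : lmodType K) (phi : N -> N -> L) : Prop :=
  [/\ bilinear_for *:%R *:%R phi, forall x, phi x x = 0
    & forall x y z, phi x ⟦y, z⟧ = phi ⟦x, y⟧ z - phi ⟦x, z⟧ y].

Definition pair_sum (L : lmodType K) (phi : N -> N -> L) (s : seq (N * N)) : L :=
  \sum_(p <- s) phi p.1 p.2.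

(* [s] stands for the sum of the [p.1 /\ p.2]; scalars are absorbed by the
   first factor. Quantifying over all targets [L] builds the universal
   property into the quotient. *)
Definition ext_equiv (s t : seq (N * N)) : bool :=
  `[< forall (L : lmodType K) (phi : N -> N -> L),
        lie_pairing phi -> pair_sum phi s = pair_sum phi t >].

Fact ext_equiv_is_equiv : equiv_class_of ext_equiv.
Proof.
split=> [s|s t|t s r]; first by apply/asboolP.
  by apply/asboolP/asboolP => st L phi phiP; rewrite st.
move=> /asboolP st /asboolP tr; apply/asboolP => L phi phiP.
by rewrite st // tr.
Qed.

Canonical ext_equiv_equiv := EquivRelPack ext_equiv_is_equiv.
Canonical ext_equiv_encModRel := defaultEncModRel ext_equiv.

Definition ext_square := {eq_quot ext_equiv}.
HB.instance Definition _ := EqQuotient.on ext_square.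
HB.instance Definition _ := Choice.on ext_square.

Definition ext_eval (L : lmodType K) (phi : N -> N -> L) (x : ext_square) : L :=
  pair_sum phi (repr x).

Lemma ext_eval_pi (L : lmodType K) (phi : N -> N -> L) s :
  lie_pairing phi -> ext_eval phi (\pi_ext_square s) = pair_sum phi s.
Proof.
move=> phiP; have /asboolP : ext_equiv (repr (\pi_ext_square s)) s.
  by apply/eqmodP; rewrite reprK.
by move=> h; exact: h.
Qed.

(** Equivalence of sums means equal values under all pairings, so the evaluations jointly separate
    points. Identities in the exterior square are therefore checked after evaluation, inside an
    ordinary vector space. *)
Lemma ext_eval_inj (x y : ext_square) :
  (forall (L : lmodType K) (phi : N -> N -> L),
     lie_pairing phi -> ext_eval phi x = ext_eval phi y) -> x = y.
Proof.
move=> xy; rewrite -[x]reprK -[y]reprK; apply/eqmodP/asboolP => L phi phiP.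
exact: xy.
Qed.

Definition ext_zero : ext_square := \pi_ext_square [::].
Definition ext_add (x y : ext_square) : ext_square :=
  \pi_ext_square (repr x ++ repr y).
Definition ext_scale (a : K) (x : ext_square) : ext_square :=
  \pi_ext_square [seq (a *: p.1, p.2) | p <- repr x].
Definition ext_opp (x : ext_square) : ext_square := ext_scale (-1) x.
Definition wedge (n n' : N) : ext_square := \pi_ext_square [:: (n, n')].

Section Evaluation.
Variables (L : lmodType K) (phi : N -> N -> L).
Hypothesis phiP : lie_pairing phi.

Lemma pairing_linl n : linear (fun n' => phi n' n).
Proof. by case: phiP => -[h _] _ _; exact: h. Qed.

Lemma pairing_linr n : linear (phi n).
Proof. by case: phiP => -[_ h] _ _; exact: h. Qed.

Lemma pairing_skew n n' : phi n n' = - phi n' n.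
Proof.
case: phiP => _ alt _; apply/eqP; rewrite -addr_eq0; apply/eqP.
have := alt (n + n').
by rewrite (linD (pairing_linl _)) !(linD (pairing_linr _)) !alt addr0 add0r.
Qed.

Lemma ext_eval0 : ext_eval phi ext_zero = 0.
Proof. by rewrite ext_eval_pi // /pair_sum big_nil. Qed.

Lemma ext_evalD x y :
  ext_eval phi (ext_add x y) = ext_eval phi x + ext_eval phi y.
Proof. by rewrite ext_eval_pi // /pair_sum big_cat. Qed.

Lemma ext_evalZ a x : ext_eval phi (ext_scale a x) = a *: ext_eval phi x.
Proof.
rewrite ext_eval_pi // /pair_sum big_map scaler_sumr; apply: eq_bigr => p _.
by rewrite (linZ (pairing_linl _)).
Qed.

Lemma ext_evalN x : ext_eval phi (ext_opp x) = - ext_eval phi x.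
Proof. by rewrite ext_evalZ scaleN1r. Qed.

Lemma ext_eval_wedge n n' : ext_eval phi (wedge n n') = phi n n'.
Proof. by rewrite ext_eval_pi // /pair_sum big_seq1. Qed.

End Evaluation.

Fact ext_addA : associative ext_add.
Proof.
by move=> x y z; apply: ext_eval_inj => L phi h; rewrite !ext_evalD ?addrA.
Qed.

Fact ext_addC : commutative ext_add.
Proof.
by move=> x y; apply: ext_eval_inj => L phi h; rewrite !ext_evalD // addrC.
Qed.

Fact ext_add0 : left_id ext_zero ext_add.
Proof.
move=> x; apply: ext_eval_inj => L phi h.
by rewrite ext_evalD // ext_eval0 // add0r.
Qed.

Fact ext_addN : left_inverse ext_zero ext_opp ext_add.
Proof.
move=> x; apply: ext_eval_inj => L phi h.
by rewrite ext_evalD // ext_evalN // addNr ext_eval0.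
Qed.

HB.instance Definition _ :=
  GRing.isZmodule.Build ext_square ext_addA ext_addC ext_add0 ext_addN.

Fact ext_scaleA a b x : ext_scale a (ext_scale b x) = ext_scale (a * b) x.
Proof. by apply: ext_eval_inj => L phi h; rewrite !ext_evalZ // scalerA. Qed.

Fact ext_scale1 : left_id 1 ext_scale.
Proof.
by move=> x; apply: ext_eval_inj => L phi h; rewrite ext_evalZ // scale1r.
Qed.

Fact ext_scaleDr : right_distributive ext_scale +%R.
Proof.
move=> a x y; apply: ext_eval_inj => L phi h.
by rewrite ext_evalZ // !ext_evalD // !ext_evalZ // scalerDr.
Qed.

Fact ext_scaleDl x : {morph ext_scale^~ x : a b / a + b}.
Proof.
move=> a b; apply: ext_eval_inj => L phi h.
by rewrite ext_evalD // !ext_evalZ // scalerDl.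
Qed.

HB.instance Definition _ := GRing.Zmodule_isLmodule.Build K ext_square
  ext_scaleA ext_scale1 ext_scaleDr ext_scaleDl.

Lemma ext_eval_linear (L : lmodType K) (phi : N -> N -> L) :
  lie_pairing phi -> linear (ext_eval phi).
Proof. by move=> phiP a x y; rewrite ext_evalD // ext_evalZ. Qed.

Lemma wedge_linl n : linear (fun n' => wedge n' n).
Proof.
move=> a x y; apply: ext_eval_inj => L phi h.
by rewrite (ext_eval_linear h) !ext_eval_wedge // (pairing_linl h).
Qed.

Lemma wedge_linr n : linear (wedge n).
Proof.
move=> a x y; apply: ext_eval_inj => L phi h.
by rewrite (ext_eval_linear h) !ext_eval_wedge // (pairing_linr h).
Qed.

(** Every element is a finite sum of wedges, scalars being absorbed by the first factors; closure
    under addition thus suffices. *)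
Lemma wedge_ind (P : set ext_square) :
  P 0 -> (forall x y, P x -> P y -> P (x + y)) ->
  (forall n n', P (wedge n n')) -> forall x, P x.
Proof.
move=> P0 PD Pw x; rewrite -[x]reprK; elim: (repr x) => [//|[n n'] s Ps].
suff -> : \pi_ext_square ((n, n') :: s) = wedge n n' + \pi_ext_square s.
  exact: PD.
apply: ext_eval_inj => L phi h.
by rewrite ext_evalD // ext_eval_wedge // !ext_eval_pi // /pair_sum big_cons.
Qed.

(** Both sides are sums over the same chosen representative of [x]. *)
Lemma ext_eval_comp (L L' : lmodType K) (g : L -> L') (phi : N -> N -> L) x :
  linear g -> g (ext_eval phi x) = ext_eval (fun n n' => g (phi n n')) x.
Proof. by move=> gl; rewrite /ext_eval /pair_sum lin_sum. Qed.

Lemma bracket_pairing : lie_pairing (@lie_bracket K N).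
Proof.
split; [exact: lie_bracket_bilinear|exact: lie_bracketxx|exact: lie_bracketA].
Qed.

Definition ext_bd (x : ext_square) : N := ext_eval lie_bracket x.

Lemma ext_bd_linear : linear ext_bd.
Proof. exact: ext_eval_linear bracket_pairing. Qed.

Lemma ext_bd_wedge n n' : ext_bd (wedge n n') = ⟦n, n'⟧.
Proof. by rewrite /ext_bd ext_eval_wedge //; exact: bracket_pairing. Qed.

(** The usual bracket of the nonabelian exterior square: on generators, the bracket of [wedge a b]
    and [wedge c d] is [wedge ⟦a, b⟧ ⟦c, d⟧]. *)
Definition ext_bracket (x y : ext_square) : ext_square :=
  wedge (ext_bd x) (ext_bd y).

Fact ext_bracket_bilinear : bilinear_for *:%R *:%R ext_bracket.
Proof.
split=> [y a x x'|x a y y'].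
  by rewrite /ext_bracket ext_bd_linear wedge_linl.
by rewrite /ext_bracket ext_bd_linear wedge_linr.
Qed.

Fact ext_bracketxx x : ext_bracket x x = 0.
Proof.
apply: ext_eval_inj => L phi h; rewrite ext_eval_wedge // ext_eval0 //.
by case: h.
Qed.

(** Evaluated at a pairing, this becomes [phi a ⟦b, c⟧ + phi b ⟦c, a⟧ + phi c ⟦a, b⟧ = 0] for the
    images [a], [b], [c] in [N], which follows from the third pairing axiom and skew-symmetry. *)
Fact ext_jacobi x y z :
  ext_bracket x (ext_bracket y z) + ext_bracket y (ext_bracket z x)
    + ext_bracket z (ext_bracket x y) = 0.
Proof.
apply: ext_eval_inj => L phi h; rewrite !ext_evalD // ext_eval0 //.
rewrite !ext_eval_wedge // !ext_bd_wedge.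
have [_ _ ->] := h.
rewrite (pairing_skew h ⟦ext_bd x, ext_bd y⟧).
rewrite (pairing_skew h ⟦ext_bd x, ext_bd z⟧) opprK (lie_skew (ext_bd z)).
by rewrite (linN (pairing_linr h _)) addrK addNr.
Qed.

HB.instance Definition _ := Lmodule_isLieAlgebra.Build K ext_square
  ext_bracket_bilinear ext_bracketxx ext_jacobi.

Lemma ext_bracketE (x y : ext_square) : ⟦x, y⟧ = wedge (ext_bd x) (ext_bd y).
Proof. by []. Qed.

End ExteriorSquare.

(** * Braidings in central extensions, and the identity crossed module *)

Section BraidedTheory.
Variable K : fieldType.
Implicit Types X Y Z : braidedCrossedModule K.

Lemma br_linl X (n : xm_cod X) : linear (fun n' : xm_cod X => ⦃n', n⦄).
Proof. by have [h _] := @bxm_br_bilinear K X; exact: h. Qed.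

Lemma br_linr X (n : xm_cod X) : linear (bxm_br n).
Proof. by have [_ h] := @bxm_br_bilinear K X; exact: h. Qed.

Section CentralExtension.
Variables (Z X : braidedCrossedModule K) (f : bxmMorphism Z X).
Hypothesis f_central : bxm_central_extension f.

(** Elements with the same image differ by an element of the braided centre, so the two arguments
    can be exchanged one after the other. *)
Lemma central_br (h h' k k' : xm_cod Z) :
  bxm_snd f h = bxm_snd f h' -> bxm_snd f k = bxm_snd f k' ->
  ⦃h, k⦄ = ⦃h', k'⦄.
Proof.
have [_ _ Z_central] := f_central; have fl := (bxm_snd_morphism f).1.
move=> hh' kk'; transitivity ⦃h', k⦄; apply/eqP; rewrite -subr_eq0; apply/eqP.
  have /Z_central/(_ k)[] : bxm_snd f (h - h') = 0
    by rewrite (linB fl) hh' subrr.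
  by rewrite (linB (br_linl _)).
have /Z_central/(_ h')[_] : bxm_snd f (k - k') = 0
  by rewrite (linB fl) kk' subrr.
by rewrite (linB (br_linr _)).
Qed.

End CentralExtension.

Lemma lie_morphism_id (L : lieAlgType K) : lie_morphism (@id L).
Proof. by split. Qed.

Definition bxm_id X : bxmMorphism X X :=
  @BxmMorphism K X X id id (lie_morphism_id _) (lie_morphism_id _)
    (fun _ _ => erefl) (fun _ => erefl) (fun _ _ => erefl).

(** Lets [ext_square_lift], applied to the identity, produce the candidate universal extension
    itself. *)
Lemma central_bxm_id X : bxm_central_extension (bxm_id X).
Proof.
split=> [|m /= -> n|n /= -> n'].
- by split=> x; exists x.
- by rewrite -bxm_br_bdr (lin0 (xm_bd_morphism _).1) (lin0 (br_linr _)).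
- by rewrite (lin0 (br_linl _)) (lin0 (br_linr _)).
Qed.

Section Identity.
Variable L : lieAlgType K.

Definition id_xm : crossedModule K :=
  @CrossedModule K L L id lie_bracket (lie_morphism_id L)
    (@lie_bracket_bilinear K L) (@lie_bracketAl K L)
    (@lie_bracketAr K L)
    (fun _ _ => erefl) (fun _ _ => erefl).

Definition id_bxm : braidedCrossedModule K :=
  @BraidedCrossedModule K id_xm lie_bracket (@lie_bracket_bilinear K L)
    (fun _ _ => erefl) (fun _ _ => erefl) (@lie_skew K L)
    (fun _ _ => erefl) (@lie_bracketA K L) (@lie_bracketAl K L).

End Identity.

(** * A perfect braided crossed module has a universal central extension *)

Section Perfect.
Variable X : braidedCrossedModule K.
Hypothesis X_perfect : bxm_perfect X.
Local Notation N := (xm_cod X).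

(** The image of the boundary is a subspace containing each [⟦x, y⟧], the boundary of [⦃x, y⦄]; by
    perfection these span [N]. *)
Lemma perfect_bd_surj (n : N) : exists m, xm_bd m = n.
Proof.
have bl := (xm_bd_morphism X).1.
have : lie_derived N n by rewrite -X_perfect.2.
apply: (smallest_sub (X := [set n | exists m, xm_bd m = n])).
  split; first by exists 0; rewrite (lin0 bl).
  by move=> a x y [m <-] [m' <-]; exists (a *: m + m'); rewrite bl.
by move=> _ [x _] [y _ <-]; exists ⦃x, y⦄; rewrite bxm_bd_br.
Qed.

(** The section [s] is merely a function, but by [central_br] its failure to respect sums, scalars
    and brackets is invisible to the braiding. *)
Lemma lift_pairing Z (f : bxmMorphism Z X) (s : N -> xm_cod Z) :
  bxm_central_extension f -> (forall n, bxm_snd f (s n) = n) ->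
  lie_pairing (fun n n' => ⦃s n, s n'⦄).
Proof.
move=> f_central sK; have [fl fb] := bxm_snd_morphism f.
have sB y z : bxm_snd f (s ⟦y, z⟧) = bxm_snd f ⟦s y, s z⟧ by rewrite fb !sK.
split; first split=> n a x y.
- by rewrite -(br_linl (s n)); apply: (central_br f_central); rewrite ?fl ?sK.
- by rewrite -(br_linr (s n)); apply: (central_br f_central); rewrite ?fl ?sK.
(* Alternation rests on perfection: [s n] can be replaced by a boundary [xm_bd l], and
   [⦃xm_bd l, xm_bd l⦄ = ⟦l, l⟧ = 0]. *)
- move=> n; have [m mn] := perfect_bd_surj n.
  have [[f1_surj _] _ _] := f_central; have [l lm] := f1_surj m.
  have ln : bxm_snd f (s n) = bxm_snd f (xm_bd l).
    by rewrite -bxm_morph_bd lm sK.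
  by rewrite (central_br f_central ln ln) bxm_br_bd lie_bracketxx.
- move=> x y z; rewrite (central_br f_central erefl (sB y z)) bxm_br_bracketr.
  by congr (_ - _); apply: (central_br f_central); rewrite ?sB.
Qed.

(** The two right-hand sides do not mention [f], so lifts through different central extensions agree
    over [X]. The first component evaluates the lifted pairing; the second must be its boundary,
    since [id_bxm] has the identity as boundary. *)
Lemma ext_square_lift Z (f : bxmMorphism Z X) : bxm_central_extension f ->
  exists h : bxmMorphism (id_bxm (ext_square N)) Z,
    (forall t, bxm_fst f (bxm_fst h t) = ext_eval (@bxm_br K X) t) /\
    (forall t, bxm_snd f (bxm_snd h t) = ext_bd t).
Proof.
move=> f_central; have [[_ f2_surj] _ _] := f_central.
have [s sK] := choice f2_surj.
have phiP := lift_pairing f_central sK.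
pose h1 (t : ext_square N) : xm_dom Z := ext_eval (fun n n' => ⦃s n, s n'⦄) t.
pose h2 t := xm_bd (h1 t).
have f1h1 t : bxm_fst f (h1 t) = ext_eval (@bxm_br K X) t.
  rewrite (ext_eval_comp _ _ (bxm_fst_morphism f).1); congr ext_eval.
  by apply/funext=> n; apply/funext=> n'; rewrite bxm_fst_br !sK.
have f2h2 t : bxm_snd f (h2 t) = ext_bd t.
  rewrite -bxm_morph_bd f1h1 (ext_eval_comp _ _ (xm_bd_morphism X).1).
  congr ext_eval.
  by apply/funext=> n; apply/funext=> n'; rewrite bxm_bd_br.
(* The left side is [⦃s (ext_bd t), s (ext_bd t')⦄], whose arguments have the same images in [N] as
   [h2 t] and [h2 t']. Bracket, action and braiding of [id_bxm] coincide, so this one identity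
   yields the compatibility of [h1] with all three. *)
have h1_br t t' : h1 ⟦t, t'⟧ = ⦃h2 t, h2 t'⦄.
  rewrite /h1 ext_bracketE ext_eval_wedge //.
  by apply: (central_br f_central); rewrite sK f2h2.
have [bdl bdb] := xm_bd_morphism Z.
have h1M : lie_morphism h1.
  by split=> [|x y]; [exact: ext_eval_linear|rewrite h1_br bxm_br_bd].
have h2M : lie_morphism h2 by exact: (lie_morphism_comp (xm_bd_morphism Z)).
have h1_act t t' : h1 ⟦t, t'⟧ = xm_act (h2 t) (h1 t').
  by rewrite h1_br bxm_br_bdr.
by exists (@BxmMorphism K (id_bxm (ext_square N)) Z h1 h2 h1M h2M h1_act
  (fun _ => erefl) h1_br).
Qed.

Lemma perfect_universal : exists U (u : bxmMorphism U X),
  bxm_universal_central_extension u.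
Proof.
have [u [uE1 uE2]] := ext_square_lift (central_bxm_id X).
have u1_wedge n n' : bxm_fst u (wedge n n') = ⦃n, n'⦄.
  rewrite [LHS]uE1 ext_eval_wedge //.
  exact: (lift_pairing (s := id) (central_bxm_id X)).
have u2_wedge n n' : bxm_snd u (wedge n n') = ⟦n, n'⟧.
  by rewrite [LHS]uE2 ext_bd_wedge.
have [u1l u1b] := bxm_fst_morphism u; have [u2l u2b] := bxm_snd_morphism u.
have u1_surj m : exists t, bxm_fst u t = m.
  have : bxm_br_subalgebra X m by rewrite -X_perfect.1.
  apply: (smallest_sub (X := [set m | exists t, bxm_fst u t = m])).
    split; first split.
    - by exists 0; rewrite (lin0 u1l).
    - by move=> a _ _ [t <-] [t' <-]; exists (a *: t + t'); rewrite u1l.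
    - by move=> _ _ [t <-] [t' <-]; exists ⟦t, t'⟧; rewrite u1b.
  by move=> _ [n _] [n' _ <-]; exists (wedge n n').
have u2_surj n : exists t, bxm_snd u t = n.
  by have [m <-] := perfect_bd_surj n; have [t <-] := u1_surj m;
    exists t; rewrite bxm_morph_bd.
(* Centrality of [u]: the bracket factors through [ext_bd], whose kernel is that of [bxm_snd u] and
   contains that of [bxm_fst u]. *)
have bracket0 (t t' : ext_square N) : ext_bd t = 0 -> ⟦t, t'⟧ = 0 /\ ⟦t', t⟧ = 0.
  move=> t0; rewrite !ext_bracketE t0.
  by rewrite (lin0 (wedge_linl _)) (lin0 (wedge_linr _)).
exists (id_bxm (ext_square N)), u; split.
  split=> // [t /= t0 t'|t /= t0 t'].
    apply: (proj2 (bracket0 _ _ _)); rewrite -uE2 /=.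
    by rewrite -[LHS](bxm_morph_bd u t) t0 (lin0 (xm_bd_morphism X).1).
  by apply: bracket0; rewrite -uE2.
move=> Z f f_central; have [h [hE1 hE2]] := ext_square_lift f_central.
exists h; split.
  by apply: bxmMorphism_eq => t /=; rewrite ?hE1 ?hE2 -?uE1 -?uE2.
move=> g ug.
have gh2 t : bxm_snd f (bxm_snd h t) = bxm_snd f (bxm_snd g t).
  by rewrite hE2 -uE2 /= ug.
have gh1 : bxm_fst h =1 bxm_fst g.
  have [h1l _] := bxm_fst_morphism h; have [g1l _] := bxm_fst_morphism g.
  apply: wedge_ind => [|x y hx hy|n n'].
  - by rewrite (lin0 h1l) (lin0 g1l).
  - by rewrite (linD h1l) (linD g1l) hx hy.
  (* Since [ext_bd] is onto, each wedge is a bracket, hence a braiding in [id_bxm]. So [h] and [g]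
     send it to braidings of elements with equal images in [N]. *)
  have [a an] := u2_surj n; have [b bn] := u2_surj n'.
  have -> : wedge n n' = ⟦a, b⟧ by rewrite ext_bracketE -!uE2 /= an bn.
  rewrite [LHS](bxm_fst_br h a b) [RHS](bxm_fst_br g a b).
  exact: (central_br f_central).
apply: bxmMorphism_eq => // t.
by rewrite -[LHS](bxm_morph_bd h t) -[RHS](bxm_morph_bd g t) gh1.
Qed.

End Perfect.
End BraidedTheory.

(** * Products of braided crossed modules *)

Section Product.
Variable K : fieldType.

Section LieProduct.
Variables L H : lieAlgType K.
Local Notation LH := (L * H)%type.

Definition prod_bracket (x y : LH) : LH := (⟦x.1, y.1⟧, ⟦x.2, y.2⟧).

Fact prod_bracket_bilinear : bilinear_for *:%R *:%R prod_bracket.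
Proof.
split=> z a x y; apply: injective_projections => /=.
- by rewrite (lie_linl z.1).
- by rewrite (lie_linl z.2).
- by rewrite (lie_linr z.1).
- by rewrite (lie_linr z.2).
Qed.

Fact prod_bracketxx x : prod_bracket x x = 0.
Proof. by apply: injective_projections => /=; exact: lie_bracketxx. Qed.

Fact prod_jacobi x y z :
  prod_bracket x (prod_bracket y z) + prod_bracket y (prod_bracket z x)
    + prod_bracket z (prod_bracket x y) = 0.
Proof. by apply: injective_projections => /=; exact: lie_jacobi. Qed.

HB.instance Definition _ := Lmodule_isLieAlgebra.Build K LH
  prod_bracket_bilinear prod_bracketxx prod_jacobi.

End LieProduct.

Variables X Y : braidedCrossedModule K.
Local Notation M := (xm_dom X * xm_dom Y)%type.
Local Notation N := (xm_cod X * xm_cod Y)%type.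

Definition prod_bd (m : M) : N := (xm_bd m.1, xm_bd m.2).
Definition prod_act (n : N) (m : M) : M := (xm_act n.1 m.1, xm_act n.2 m.2).
Definition prod_br (n n' : N) : M := (⦃n.1, n'.1⦄, ⦃n.2, n'.2⦄).

Fact prod_bd_morphism : lie_morphism prod_bd.
Proof.
have [Xl Xb] := xm_bd_morphism X; have [Yl Yb] := xm_bd_morphism Y.
split=> [a x y|x y]; apply: injective_projections => /=.
- exact: Xl.
- exact: Yl.
- exact: Xb.
- exact: Yb.
Qed.

Fact prod_act_bilinear : bilinear_for *:%R *:%R prod_act.
Proof.
have [Xl Xr] := @xm_act_bilinear K X; have [Yl Yr] := @xm_act_bilinear K Y.
split=> z a x y; apply: injective_projections => /=.
- exact: Xl.
- exact: Yl.
- exact: Xr.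
- exact: Yr.
Qed.

Fact prod_br_bilinear : bilinear_for *:%R *:%R prod_br.
Proof.
split=> z a x y; apply: injective_projections => /=.
- exact: (br_linl z.1).
- exact: (br_linl z.2).
- exact: (br_linr z.1).
- exact: (br_linr z.2).
Qed.

(** Kept transparent, like the constructions after it, so that the laws of the projection hold by
    conversion. *)
Definition prod_xm : crossedModule K.
Proof.
apply: (@CrossedModule K M N prod_bd prod_act prod_bd_morphism prod_act_bilinear).
- by move=> n n' m; apply: injective_projections; exact: xm_act_bracketl.
- by move=> n m m'; apply: injective_projections; exact: xm_act_bracketr.
- by move=> n m; apply: injective_projections; exact: xm_bd_act.
- by move=> m m'; apply: injective_projections; exact: xm_peiffer.
Defined.

Definition prod_bxm : braidedCrossedModule K.
Proof.
apply: (@BraidedCrossedModule K prod_xm prod_br prod_br_bilinear).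
- by move=> n n'; apply: injective_projections; exact: bxm_bd_br.
- by move=> m m'; apply: injective_projections; exact: bxm_br_bd.
- by move=> m n; apply: injective_projections; exact: bxm_br_bdl.
- by move=> n m; apply: injective_projections; exact: bxm_br_bdr.
- by move=> n n' n''; apply: injective_projections; exact: bxm_br_bracketr.
- by move=> n n' n''; apply: injective_projections; exact: bxm_br_bracketl.
Defined.

Definition prod_fst : bxmMorphism prod_bxm X.
Proof.
by exists (fst : xm_dom prod_bxm -> xm_dom X)
          (fst : xm_cod prod_bxm -> xm_cod X).
Defined.

Definition prod_pair (U : braidedCrossedModule K)
  (f : bxmMorphism U X) (g : bxmMorphism U Y) : bxmMorphism U prod_bxm.
Proof.
exists (fun m => (bxm_fst f m, bxm_fst g m) : xm_dom prod_bxm)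
       (fun n => (bxm_snd f n, bxm_snd g n) : xm_cod prod_bxm).
- have [fl fb] := bxm_fst_morphism f; have [gl gb] := bxm_fst_morphism g.
  by split=> [a x y|x y]; rewrite ?fl ?gl ?fb ?gb.
- have [fl fb] := bxm_snd_morphism f; have [gl gb] := bxm_snd_morphism g.
  by split=> [a x y|x y]; rewrite ?fl ?gl ?fb ?gb.
- by move=> n m; rewrite !bxm_fst_act.
- by move=> m; apply: injective_projections; exact: bxm_morph_bd.
- by move=> n n'; rewrite !bxm_fst_br.
Defined.

End Product.

(** * Abelian braided crossed modules *)

Section Abelian.
Variables (K : fieldType) (V : lmodType K).

(** An alias that carries the zero bracket. *)
Definition abelian : Type := V.
HB.instance Definition _ := GRing.Lmodule.on abelian.

Definition abelian_bracket (x y : abelian) : abelian := 0.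

Fact abelian_bracket_bilinear : bilinear_for *:%R *:%R abelian_bracket.
Proof. by split=> z a x y; rewrite /abelian_bracket /= scaler0 addr0. Qed.

Fact abelian_bracketxx x : abelian_bracket x x = 0. Proof. by []. Qed.

Fact abelian_jacobi x y z :
  abelian_bracket x (abelian_bracket y z)
    + abelian_bracket y (abelian_bracket z x)
    + abelian_bracket z (abelian_bracket x y) = 0.
Proof. by rewrite /abelian_bracket !addr0. Qed.

HB.instance Definition _ := Lmodule_isLieAlgebra.Build K abelian
  abelian_bracket_bilinear abelian_bracketxx abelian_jacobi.

Lemma abelianE (x y : abelian) : ⟦x, y⟧ = 0. Proof. by []. Qed.

Variable d : abelian -> abelian.
Hypothesis d_lin : linear d.

(** Any linear [d] can serve as boundary: [d = 0] will detect M / B_N(M), and [d = id] will detect N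
    / [N, N]. *)
Definition abelian_xm : crossedModule K.
Proof.
apply: (@CrossedModule K abelian abelian d abelian_bracket) => //.
- by split=> // x y; rewrite !abelianE (lin0 d_lin).
- exact: abelian_bracket_bilinear.
- by move=> *; rewrite /abelian_bracket subr0.
- by move=> *; rewrite !abelianE addr0.
- by move=> *; rewrite (lin0 d_lin).
Defined.

Definition abelian_bxm : braidedCrossedModule K.
Proof.
apply: (@BraidedCrossedModule K abelian_xm abelian_bracket) => //=.
- exact: abelian_bracket_bilinear.
- by move=> *; rewrite (lin0 d_lin).
- by move=> *; rewrite oppr0.
- by move=> *; rewrite /abelian_bracket subr0.
- by move=> *; rewrite /abelian_bracket subr0.
Defined.

End Abelian.

(** * A universal central extension forces perfection *)

Section UniversalPerfect.
Variables (K : fieldType) (X U : braidedCrossedModule K) (u : bxmMorphism U X).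
Hypothesis u_universal : bxm_universal_central_extension u.

(* [(u, g u)] and [(u, 0)] are both lifts of [u] to the central extension
   [X * A -> X]. *)
Lemma universal_abelian_trivial (V : lmodType K) (d : abelian V -> abelian V)
    (d_lin : linear d) (g : bxmMorphism X (abelian_bxm d_lin)) :
  (forall m, bxm_fst g m = 0) /\ (forall n, bxm_snd g n = 0).
Proof.
have [[[u1_surj u2_surj] _ _] univ] := u_universal.
set A := abelian_bxm d_lin.
have lie_zero (L H : lieAlgType K) : lie_morphism (fun _ : L => 0 : H).
  split=> [a x y|x y]; first by rewrite scaler0 addr0.
  by rewrite (lin0 (lie_linr _)).
pose z : bxmMorphism X A := @BxmMorphism K X A (fun=> 0) (fun=> 0)
  (lie_zero _ _) (lie_zero _ _) (fun _ _ => erefl) (fun _ => lin0 d_lin)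
  (fun _ _ => erefl).
(* A kernel element has component 0 in [X], where bilinearity applies, while action and braiding of
   [A] are zero. *)
have central : bxm_central_extension (prod_fst X A).
  split=> [|[m a] /= -> [n b]|[n a] /= -> [n' b]].
  - by split=> x; exists (x, 0).
  - congr (_, _); rewrite -bxm_br_bdr.
    by rewrite (lin0 (xm_bd_morphism X).1) (lin0 (br_linr _)).
  - by split; congr (_, _); rewrite ?(lin0 (br_linr _)) ?(lin0 (br_linl _)).
have [h [_ h_uniq]] := univ _ _ central.
have lift (k : bxmMorphism X A) :
    u = bxm_comp (prod_fst X A) (prod_pair u (bxm_comp k u)).
  exact: bxmMorphism_eq.
have E : prod_pair u (bxm_comp g u) = prod_pair u (bxm_comp z u).
  by rewrite -(h_uniq _ (lift g)) -(h_uniq _ (lift z)).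
(* The second components of [E] say that [g] vanishes on the image of [u], which is everything. *)
split=> x.
  have [t <-] := u1_surj x.
  by have := congr1 (fun k : bxmMorphism _ (prod_bxm X A) => snd (bxm_fst k t)) E.
have [t <-] := u2_surj x.
by have := congr1 (fun k : bxmMorphism _ (prod_bxm X A) => snd (bxm_snd k t)) E.
Qed.

Lemma universal_perfect : bxm_perfect X.
Proof.
have [bdl bdb] := xm_bd_morphism X.
split; apply/seteqP; split=> // x _.
  have B_sub := lie_subalgebra_generated
    [set ⦃n, n'⦄ | n in [set: xm_cod X] & n' in [set: xm_cod X]].
  have B_br (n n' : xm_cod X) : bxm_br_subalgebra X ⦃n, n'⦄.
    by apply: sub_gen_smallest; exists n => //; exists n'.
  have [V [q [q_lin qP]]] := quotient_lmodP B_sub.1.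
  have q_br (n n' : xm_cod X) : q ⦃n, n'⦄ = 0 by apply/qP; exact: B_br.
  have zero_lin : linear (fun _ : abelian V => 0 : abelian V).
    by move=> a y z; rewrite scaler0 addr0.
  apply/qP.
  (* The morphism is [(q, 0)]. Brackets in M and actions are themselves braidings, by [bxm_br_bd]
     and [bxm_br_bdr], so [q] kills them all. *)
  suff g : {g : bxmMorphism X (abelian_bxm zero_lin) | bxm_fst g = q}.
    by case: g => g <-; have [] := universal_abelian_trivial g.
  have qM : lie_morphism (q : _ -> abelian V).
    by split=> // y z; rewrite -bxm_br_bd q_br.
  have zM : lie_morphism (fun _ : xm_cod X => 0 : abelian V).
    by split=> // a y z; rewrite scaler0 addr0.
  by unshelve eexists (BxmMorphism (Y := abelian_bxm zero_lin) qM zM _ _ _) => //=;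
    move=> n m; rewrite -?bxm_br_bdr q_br.
have [V [q [q_lin qP]]] := quotient_lmodP (subspace_derived (xm_cod X)).
have q_br (n n' : xm_cod X) : q ⟦n, n'⟧ = 0 by apply/qP; exact: derived_bracket.
have id_lin : linear (id : abelian V -> abelian V) by [].
apply/qP.
(* With identity boundary the first component has to be [q] after [xm_bd]; it kills actions and
   braidings because their boundaries are brackets in N. *)
suff g : {g : bxmMorphism X (abelian_bxm id_lin) | bxm_snd g = q}.
  by case: g => g <-; have [] := universal_abelian_trivial g.
have qM : lie_morphism (q : _ -> abelian V) by split=> // y z; rewrite q_br.
have qbM : lie_morphism (fun m : xm_dom X => q (xm_bd m) : abelian V).
  exact: (lie_morphism_comp qM (xm_bd_morphism X)).
by unshelve eexists (BxmMorphism (Y := abelian_bxm id_lin) qbM qM _ _ _) => //=;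
  move=> n m; rewrite ?xm_bd_act ?bxm_bd_br q_br.
Qed.

End UniversalPerfect.

Theorem theorem2p12 (K : fieldType) (X : braidedCrossedModule K) :
  (exists (U : braidedCrossedModule K) (u : bxmMorphism U X),
      bxm_universal_central_extension u) <->
  bxm_perfect X.
Proof.
split=> [[U [u u_universal]]|]; first exact: universal_perfect u_universal.
exact: perfect_universal.
Qed.
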